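(* (1) $\mathcal{K}_{y|\vec{x}}\subset\mathcal{S}_{y|x}$; and (2) $\dim(\mathcal{G}_{y|\vec{x}})\le\dim(\mathcal{S}_{y|x})$.
   Context: Let $p>1$, let $Y$ be a real random variable and let $X$ be a random vector in $\mathbb{R}^p$ with an elliptically symmetric distribution, standardized to have location $0$ and scatter matrix $I_p$; i.e. $X$ has a Lebesgue density of the form $x\mapsto f(\|x\|^2)$, with $\|\cdot\|$ the Euclidean norm. Put $\vec{X}=X/\|X\|$. For a matrix $H$, $\mathcal{S}(H)$ is its column space; the zero-dimensional subspace is allowed. Sufficient dimension reduction (SDR) subspace: a subspace $\mathcal{S}(A)$, $A\in\mathbb{R}^{p\times d}$, such that $Y$ is conditionally independent of $X$ given $A^\top X$. The central subspace (CS) $\mathcal{S}_{y|x}$ is the intersection of all SDR subspaces, provided this intersection is itself an SDR subspace; it is assumed throughout that the CS exists. Sufficient contour subspace (SCS): a subspace $\mathcal{S}(B)$, $B\in\mathbb{R}^{p\times d}$, such that $Y$ is conditionally independent of $\vec{X}$ given $B^\top\vec{X}$. Kernel contour subspace: $\mathcal{K}_{y|\vec{x}}$ is the intersection of all SCSs. A generalized contour subspace (GCS) $\mathcal{G}_{y|\vec{x}}$ is an SCS having the smallest dimension among all SCSs. *)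

(* Defs.v *)
From HB Require Import structures.
From mathcomp Require Import all_boot all_order all_algebra.
From mathcomp Require Import all_classical all_reals all_analysis.

Set Implicit Arguments.
Unset Strict Implicit.
Unset Printing Implicit Defensive.
Import Order.TTheory GRing.Theory Num.Theory.
Import numFieldNormedType.Exports.

Local Open Scope classical_set_scope.
Local Open Scope ring_scope.

Definition measure_cV_display : measure_display -> measure_display.
Proof. exact. Qed.

Section measurable_cV.
Context {d} {T : measurableType d}.
Variable n : nat.

Let coord (i : 'I_n) (x : 'cV[T]_n) : T := x i 0.

Let cV_set0 : g_sigma_preimage coord set0.
Proof. exact: sigma_algebra0. Qed.

Let cV_setC A : g_sigma_preimage coord A -> g_sigma_preimage coord (~` A).
Proof. exact: sigma_algebraC. Qed.

Let cV_bigcup (F : _^nat) : (forall i, g_sigma_preimage coord (F i)) ->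
  g_sigma_preimage coord (\bigcup_i (F i)).
Proof. exact: sigma_algebra_bigcup. Qed.

(* Column vectors carry the product sigma-algebra of the entries; over a
   [realType] this is the Borel sigma-algebra of R^n. *)
HB.instance Definition _ := @isMeasurable.Build (measure_cV_display d)
  'cV[T]_n (g_sigma_preimage coord) cV_set0 cV_setC cV_bigcup.

Lemma measurable_coord (i : 'I_n) :
  measurable_fun [set: 'cV[T]_n] (fun x => x i 0).
Proof.
move=> _ Y mY; rewrite setTI; apply: sub_sigma_algebra => /=.
rewrite -bigcup_seq/=; exists i => /=; first by rewrite mem_index_enum.
by exists Y => //; rewrite setTI.
Qed.

Lemma measurable_fun_coordP d' (U : measurableType d') (f : U -> 'cV[T]_n) :
  (forall i, measurable_fun [set: U] (fun u => f u i 0)) ->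
  measurable_fun [set: U] f.
Proof.
move=> mf; rewrite /measurable_fun => _ /= B mB; rewrite setTI.
have : g_sigma_preimage (fun i u => f u i 0) `<=` @measurable _ U.
  apply: smallest_sub; first exact: sigma_algebra_measurable.
  rewrite -bigcup_seq => A [i _ [C mC <-]].
  exact: (mf i measurableT C mC).
apply; rewrite (@g_sigma_preimage_comp _ _ _ _ coord _ f).
by exists B => //; rewrite setTI.
Qed.

End measurable_cV.

Section lebesgue_cV.
Context {R : realType}.

Definition cV_cons n (z : measurableTypeR R * 'cV[R]_n) : 'cV[R]_n.+1 :=
  \col_i oapp (fun j => z.2 j 0) z.1 (unlift ord0 i).

Definition cV_uncons n (x : 'cV[R]_n.+1) : measurableTypeR R * 'cV[R]_n :=
  (x ord0 0, \col_j x (lift ord0 j) 0).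

Lemma cV_consK n : cancel (@cV_cons n) (@cV_uncons n).
Proof.
move=> [a v]; rewrite /cV_cons /cV_uncons mxE unlift_none /=; congr pair.
by apply/matrixP => i j; rewrite !mxE liftK /= (ord1 j).
Qed.

Lemma measurable_cV_cons n : measurable_fun setT (@cV_cons n).
Proof.
apply: measurable_fun_coordP => i; rewrite /cV_cons.
under eq_fun do rewrite mxE.
case: (unlift ord0 i) => [j|] /=; last exact: measurable_fst.
exact: (measurableT_comp (measurable_coord j) measurable_snd).
Qed.

Lemma measurable_cV_uncons n : measurable_fun setT (@cV_uncons n).
Proof.
apply/measurable_fun_pairP; split; first exact: measurable_coord.
apply: measurable_fun_coordP => j /=.
by under eq_fun do rewrite mxE; exact: measurable_coord.
Qed.

Section step.
Variables (n : nat) (m : {sigma_finite_measure set 'cV[R]_n -> \bar R}).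

Definition lebesgue_cV_step : set 'cV[R]_n.+1 -> \bar R :=
  pushforward (lebesgue_measure \x m)%E (@cV_cons n).

Let step0 : lebesgue_cV_step set0 = 0%E.
Proof. by rewrite /lebesgue_cV_step /pushforward preimage_set0 measure0. Qed.

Let step_ge0 A : (0 <= lebesgue_cV_step A)%E.
Proof. by rewrite /lebesgue_cV_step /pushforward; exact: measure_ge0. Qed.

Let step_semi_sigma_additive : semi_sigma_additive lebesgue_cV_step.
Proof.
move=> F mF tF mUF; rewrite /lebesgue_cV_step /pushforward preimage_bigcup.
have mp A : measurable A -> measurable (@cV_cons n @^-1` A).
  by move=> mA; rewrite -[X in measurable X]setTI; exact: measurable_cV_cons.
apply: measure_semi_sigma_additive.
- by move=> k; exact: mp.
- apply/trivIsetP => /= i j _ _ ij; rewrite -preimage_setI.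
  by move/trivIsetP : tF => /(_ _ _ _ _ ij) ->//; rewrite preimage_set0.
- by rewrite -preimage_bigcup; exact: mp.
Qed.

HB.instance Definition _ := isMeasure.Build _ _ _ lebesgue_cV_step
  step0 step_ge0 step_semi_sigma_additive.

Let step_sigma_finite : sigma_finite setT lebesgue_cV_step.
Proof.
have /sigma_finiteP[F [TF ndF Foo]] := sigma_finiteT (@lebesgue_measure R).
have /sigma_finiteP[G [TG ndG Goo]] := sigma_finiteT m.
exists (fun k => @cV_uncons n @^-1` (F k `*` G k)).
  rewrite -preimage_bigcup -(preimage_setT (@cV_uncons n)); congr (_ @^-1` _).
  rewrite -setXTT TF TG predeqE => -[x y]; split.
    move=> [/= [k _ Fkx] [l _ Gly]]; exists (maxn k l) => //; split.
    - by move: x Fkx; exact/subsetPset/ndF/leq_maxl.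
    - by move: y Gly; exact/subsetPset/ndG/leq_maxr.
  by move=> [k _ []/= ? ?]; split; exists k.
move=> k; have [mF Fk] := Foo k; have [mG Gk] := Goo k; split.
  rewrite -[X in measurable X]setTI.
  exact: measurable_cV_uncons (measurableX mF mG).
rewrite /lebesgue_cV_step /pushforward -comp_preimage.
rewrite (_ : _ \o _ = id) ?preimage_id; last first.
  by apply/funext => z /=; exact: cV_consK.
by rewrite product_measure1E// lte_mul_pinfty// ge0_fin_numE.
Qed.

HB.instance Definition _ := Measure_isSigmaFinite.Build _ _ _ lebesgue_cV_step
  step_sigma_finite.

End step.

(* n-dimensional Lebesgue measure, as the n-fold product measure; see
   [lebesgue_cV_box] for its values on boxes. *)
Fixpoint lebesgue_cV n : {sigma_finite_measure set 'cV[R]_n -> \bar R} :=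
  match n with
  | 0%N => \d_(0 : 'cV[R]_0)
  | n'.+1 => lebesgue_cV_step (lebesgue_cV n')
  end.

Lemma lebesgue_cV_box n (a b : 'cV[R]_n) : (forall i, a i 0 <= b i 0)%R ->
  lebesgue_cV n [set x | forall i, x i 0 \in `]a i 0, b i 0]] =
  (\prod_(i < n) (b i 0 - a i 0))%:E.
Proof.
elim: n a b => [|n IH] a b ab.
  by rewrite big_ord0 /= diracE mem_set // => -[].
rewrite big_ord_recl /= /lebesgue_cV_step /pushforward.
pose a' := (cV_uncons a).2; pose b' := (cV_uncons b).2.
rewrite (_ : _ @^-1` _ = `]a ord0 0, b ord0 0]%classic `*`
    [set x : 'cV[R]_n | forall i, x i 0 \in `]a' i 0, b' i 0]]); last first.
  apply/seteqP; split => [[x v] /= H|[x v] /= [H1 H2] i].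
    split; first by have := H ord0; rewrite /cV_cons mxE unlift_none.
    by move=> i; have := H (lift ord0 i); rewrite /cV_cons !mxE liftK.
  rewrite /cV_cons mxE; case: unliftP => [j|] -> //=.
  by have := H2 j; rewrite !mxE.
have mbox : measurable [set x : 'cV[R]_n | forall i, x i 0 \in `]a' i 0, b' i 0]].
  rewrite (_ : mkset _ = \bigcap_(i in [set: 'I_n])
     [set x : 'cV[R]_n | x i 0 \in `]a' i 0, b' i 0]]); last first.
    by apply/seteqP; split => x /= H i; [move=> _|]; exact: H.
  apply: fin_bigcap_measurable => // i _.
  rewrite -[X in measurable X]setTI.
  have := measurable_coord i measurableT (measurable_itv `]a' i 0, b' i 0]).
  exact.
rewrite product_measure1E //.
have leb1 : lebesgue_measure (`]a ord0 0, b ord0 0]%classic : set R) =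
    (b ord0 0 - a ord0 0)%:E.
  rewrite lebesgue_measure_itv /= lte_fin; case: ifPn => //; rewrite -leNgt => ba.
  by rewrite (@le_anti _ _ (a ord0 0) (b ord0 0)) ?subrr// ab ba.
rewrite [X in (X * _)%E](leb1 : _ = _) IH => [|i]; last by rewrite !mxE.
by rewrite EFinM; congr (_ * _%:E)%E; apply: eq_bigr => i _; rewrite !mxE.
Qed.

End lebesgue_cV.

(* Euclidean norm; the library's [`|x|] on matrices is the sup norm. *)
Definition enorm {R : realType} {n} (x : 'cV[R]_n) : R :=
  Num.sqrt (\sum_i x i 0 ^+ 2).

(* x / ||x||, with value 0 at x = 0 *)
Definition edir {R : realType} {n} (x : 'cV[R]_n) : 'cV[R]_n :=
  (enorm x)^-1 *: x.

Definition colspace {R : realType} {m n} (A : 'M[R]_(m, n)) :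
  {vspace 'cV[R]_m} := limg (linfun (mulmx A : 'cV[R]_n -> 'cV[R]_m)).

Section probability.
Context {d} {T : measurableType d} {R : realType} (P : probability T R).

Definition has_lebesgue_density {n} (X : T -> 'cV[R]_n) (g : 'cV[R]_n -> R) :=
  [/\ measurable_fun setT g, forall x, 0 <= g x &
    forall B, measurable B ->
      P (X @^-1` B) = (\int[lebesgue_cV n]_(x in B) (g x)%:E)%E].

(* elliptically symmetric with location 0 and identity scatter matrix *)
Definition spherical {n} (X : T -> 'cV[R]_n) :=
  exists f : R -> R, has_lebesgue_density X (fun x => f (enorm x ^+ 2)).

(* u is a version of the conditional probability P(E | Z), i.e. u is
   sigma(Z)-measurable and has the same integral as the indicator of E over
   every event of sigma(Z). *)
Definition is_cond_prob {dZ} {TZ : measurableType dZ} (Z : T -> TZ)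
    (E : set T) (u : T -> R) :=
  [/\ forall V, measurable V ->
        preimage_set_system setT Z measurable (u @^-1` V),
      P.-integrable setT (EFin \o u) &
      forall D, measurable D ->
        (\int[P]_(w in Z @^-1` D) (u w)%:E)%E = P (E `&` Z @^-1` D)].

(* X and Y are conditionally independent given Z; versions of the conditional
   probabilities exist and are unique almost everywhere, so that their
   existential quantification is immaterial. *)
Definition cond_indep {d1 d2 d3} {T1 : measurableType d1}
    {T2 : measurableType d2} {T3 : measurableType d3}
    (Y : T -> T1) (X : T -> T2) (Z : T -> T3) :=
  forall B C, measurable B -> measurable C ->
  exists u v r, [/\ is_cond_prob Z (Y @^-1` B) u,
    is_cond_prob Z (X @^-1` C) v,
    is_cond_prob Z (Y @^-1` B `&` X @^-1` C) r &
    {ae P, forall w, r w = u w * v w}].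

Section subspaces.
Context {p : nat} (Y : T -> R) (X : T -> 'cV[R]_p).

Definition is_SDR (S : {vspace 'cV[R]_p}) :=
  exists k (A : 'M[R]_(p, k)),
    S = colspace A /\ cond_indep Y X (fun w => A^T *m X w).

Definition is_central_subspace (S : {vspace 'cV[R]_p}) :=
  is_SDR S /\ [set` S] = \bigcap_(U in is_SDR) [set` U].

Definition is_SCS (S : {vspace 'cV[R]_p}) :=
  exists k (B : 'M[R]_(p, k)),
    S = colspace B /\
    cond_indep Y (edir \o X) (fun w => B^T *m edir (X w)).

Definition kernel_contour_subspace : set 'cV[R]_p :=
  \bigcap_(U in is_SCS) [set` U].

Definition is_GCS (G : {vspace 'cV[R]_p}) :=
  is_SCS G /\ forall U, is_SCS U -> (\dim G <= \dim U)%N.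

End subspaces.
End probability.

(* Main.v *)
From HB Require Import structures.
Require Import Defs.
From mathcomp Require Import all_boot all_order all_algebra.
From mathcomp Require Import lra.
From mathcomp Require Import all_classical all_reals all_analysis.
From mathcomp Require Import measurable_realfun.

Set Implicit Arguments.
Unset Strict Implicit.
Unset Printing Implicit Defensive.
Import Order.TTheory GRing.Theory Num.Theory.
Import numFieldNormedType.Exports.

Local Open Scope classical_set_scope.
Local Open Scope ring_scope.

(** Let S be the column space of A and suppose that Y and X are conditionally
independent given A^T X.  The same matrix A then witnesses that S is a
sufficient contour subspace, and both claims follow at once: the central
subspace is one of the sets whose intersection is the kernel contour subspace,
and one of the subspaces among which a generalized contour subspace has least
dimension.

Write X = |X| U with U the direction of X, and fix an event Y \in B.
Conditional independence says that P(Y \in B | X) = h(A^T X) for some h >= 0,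
in the form: the integral of h(A^T X) over any event of X is the probability
that Y \in B within that event ([cond_indep_regression]).  Now |X| and U are
independent because the density of X is radial ([spherical_indep]), so
averaging h(|X| A^T U) over the law of |X| with U kept fixed
([indep_integral]) gives P(Y \in B | U) = hbar(A^T U), where hbar(z) is the
mean of h(|X| z).  As this is a function of A^T U only, Y and U are
conditionally independent given A^T U ([cond_indep_of_regression],
[SDR_SCS]).

Independence of |X| and U rests on the scaling of Lebesgue measure,
lambda(tE) = t^n lambda(E): for a cone K the measure of the vectors of K of
norm less than t is t^n times its value at t = 1.  Hence the laws of the norm
on K and on the whole space are proportional ([cone_proportional]), and they
remain so after integrating a function of the norm.

The passage between conditional independence and such integral identities uses
a nonnegative version of P(E | Z) of the form k(Z) that can be pulled out of
integrals ([cond_prob_pullout], from the Radon-Nikodym theorem), and the fact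
that all versions agree almost everywhere, which reduces to functions of Z by
the Doob-Dynkin factorization ([sigma_preimage_factor]). *)

(** * Integration tools *)

Lemma preimage_measurable d d' (T : measurableType d) (T' : measurableType d')
    (f : T -> T') D :
  measurable_fun setT f -> measurable D -> measurable (f @^-1` D).
Proof. by move=> mf mD; rewrite -[X in measurable X]setTI; exact: mf. Qed.

Lemma ge0_integral_mrestr d (T : measurableType d) (R : realType)
    (m : {measure set T -> \bar R}) (E D : set T) (mE : measurable E)
    (f : T -> \bar R) :
  measurable D -> measurable_fun D f -> (forall x, D x -> 0 <= f x)%E ->
  (\int[mrestr m mE]_(x in D) f x = \int[m]_(x in D `&` E) f x)%E.
Proof.
move=> mD mf f0.
(* the complement of E is null for the restricted measure, and on subsets of E
   both measures agree *)
rewrite [LHS](@ge0_negligible_integral _ _ _ _ _ (~` E))//.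
- rewrite setDE setCK; apply: eq_measure_integral => A mA AE.
  by rewrite /= /mrestr setIidl// => x /AE[].
- exact: measurableC.
- by rewrite /= /mrestr setICl measure0.
Qed.

Section independence.
Context d (T : measurableType d) (R : realType) (P : probability T R).
Context d1 d2 (T1 : measurableType d1) (T2 : measurableType d2).
Variables (U : {mfun T >-> T1}) (V : {mfun T >-> T2}).
Hypothesis UV : forall C D, measurable C -> measurable D ->
  P (U @^-1` C `&` V @^-1` D) = (P (U @^-1` C) * P (V @^-1` D))%E.

Let indep_integralT (g : T1 * T2 -> \bar R) :
  measurable_fun setT g -> (forall z, 0 <= g z)%E ->
  (\int[P]_w g (U w, V w) = \int[P]_w \int[distribution P V]_y g (U w, y))%E.
Proof.
move=> mg g0.
have mUV : measurable_fun setT (fun w => (U w, V w)).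
  exact: measurable_fun_pair.
rewrite -[LHS]/(\int[P]_w (g \o (fun w => (U w, V w))) w)%E.
rewrite -[in LHS](preimage_setT (fun w => (U w, V w))).
rewrite -ge0_integral_pushforward//.
rewrite (eq_measure_integral (distribution P U \x distribution P V)%E);
  last first.
  move=> A mA _; apply/esym.
  by apply: (product_measure_unique
    (m' := pushforward P (fun w => (U w, V w)))).
rewrite fubini_tonelli1// ge0_integral_distribution//.
  exact: measurable_fun_fubini_tonelli_F.
by move=> x; exact: integral_ge0.
Qed.

(** Independence makes the joint law a product, so that on an event of U the
    variable V may be averaged out with U kept fixed. *)
Lemma indep_integral (g : T1 * T2 -> \bar R) C :
  measurable_fun setT g -> (forall z, 0 <= g z)%E -> measurable C ->
  (\int[P]_(w in U @^-1` C) g (U w, V w) =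
   \int[P]_(w in U @^-1` C) \int[distribution P V]_y g (U w, y))%E.
Proof.
move=> mg g0 mC; rewrite integral_mkcond [RHS]integral_mkcond.
have mCT : measurable (C `*` [set: T2]) by exact: measurableX.
have inCT (x : T1) (y : T2) : ((x, y) \in C `*` setT) = (x \in C).
  by apply/idP/idP => [/set_mem[/mem_set]|/set_mem Cx]//; apply/mem_set.
have inUC w : (w \in U @^-1` C) = (U w \in C) by [].
transitivity (\int[P]_w (g \_ (C `*` setT)) (U w, V w))%E.
  by apply: eq_integral => w _; rewrite !patchE inCT -inUC.
rewrite indep_integralT.
- apply: eq_integral => w _; under eq_integral do rewrite patchE inCT.
  by rewrite patchE inUC; case: ifPn => // _; rewrite integral0.
- by apply/(measurable_restrictT _ mCT); exact: measurable_funTS.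
- by move=> z; rewrite patchE; case: ifPn.
Qed.

End independence.

(** * Conditional probabilities given a random element *)

Section conditional_probability.
Context d (T : measurableType d) (R : realType).

(** Doob-Dynkin: the events u < q for q rational are preimages of sets D q, and
    h z is the infimum of the q such that z belongs to D q.  The infimum is
    taken in the extended reals, as z may be outside the range of Z. *)
Lemma sigma_preimage_factor dZ (TZ : measurableType dZ) (Z : T -> TZ)
    (u : T -> R) :
  (forall V, measurable V ->
    preimage_set_system setT Z measurable (u @^-1` V)) ->
  exists2 h : TZ -> R, measurable_fun setT h & u = h \o Z.
Proof.
move=> uZ.
have /choice[D mD] (n : nat) : exists D : set TZ, measurable D /\
    Z @^-1` D = [set w | if unpickle n is Some q then u w < ratr q else False].
  case: (unpickle n) => [q|]; last first.
    by exists set0; split => //; rewrite preimage_set0.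
  have [D mD DE] := uZ _ (measurable_itv `]-oo, (ratr q : R)[).
  exists D; split => //; rewrite -[LHS]setTI DE.
  by apply/seteqP; split => w /=; rewrite in_itv.
pose q_ n : \bar R := if @unpickle rat n is Some q then (ratr q)%:E else +oo%E.
pose g n z := if z \in D n then q_ n else +oo%E.
pose h (z : TZ) : \bar R := einfs (g ^~ z) 0.
have mh : measurable_fun setT h.
  apply: measurable_fun_einfs => n.
  apply: measurable_fun_ifT => //.
  apply: (measurable_fun_bool true); rewrite setTI.
  rewrite [X in measurable X](_ : _ = D n); first exact: (mD n).1.
  by apply/seteqP; split=> z; [move/set_mem|move/mem_set].
exists (fine \o h); first exact: measurableT_comp.
apply/funext => w /=; apply: EFin_inj.
suff -> : h (Z w) = (u w)%:E by [].
have inD n : (Z w \in D n) =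
    if unpickle n is Some q then u w < ratr q else false.
  have DE : D n (Z w) = _ := congr1 (@^~ w) (mD n).2.
  apply/idP/idP => [|H]; rewrite inE DE /=; first by case: unpickle.
  by move: H; case: unpickle.
rewrite /h /einfs; apply/eqP; rewrite eq_le; apply/andP; split.
  apply/lee_addgt0Pr => e e0; rewrite -EFinD.
  have [q] := rat_in_itvoo (ltr_pwDr e0 (lexx (u w))).
  rewrite in_itv /= => /andP[uq qe].
  apply: ge_ereal_inf => /=.
  exists (g (pickle q) (Z w)); first by exists (pickle q).
  by rewrite /g inD /q_ !pickleK uq lee_fin ltW.
apply: le_ereal_inf_tmp => _ [n _ <-]; rewrite /g inD /q_.
case: (@unpickle rat n) => [q|]; rewrite ?leey//.
by case: ifPn; rewrite ?leey// lee_fin => /ltW.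
Qed.

Context (P : probability T R) dZ (TZ : measurableType dZ).
Variable Z : {mfun T >-> TZ}.

Section event_law.
Variables (E : set T) (mE : measurable E).

(** Its density with respect to the law of Z is the conditional probability of E
    given Z. *)
Definition event_law : set TZ -> \bar R := pushforward (mrestr P mE) Z.

Let event_law0 : event_law set0 = 0%E.
Proof. exact: measure0. Qed.

Let event_law_ge0 A : (0 <= event_law A)%E.
Proof. exact: measure_ge0. Qed.

Let event_law_sigma_additive : semi_sigma_additive event_law.
Proof. exact: measure_semi_sigma_additive. Qed.

HB.instance Definition _ := isMeasure.Build _ _ _ event_law
  event_law0 event_law_ge0 event_law_sigma_additive.

Let event_law_fin : fin_num_fun event_law.
Proof.
move=> D mD; rewrite /event_law /pushforward /= /mrestr fin_num_measure//.
by apply: measurableI => //; exact: preimage_measurable.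
Qed.

HB.instance Definition _ :=
  Measure_isFinite.Build _ _ _ event_law event_law_fin.

Lemma event_law_dominates : event_law `<< distribution P Z.
Proof.
move=> D D0 A mA AD.
have mZA : measurable (Z @^-1` A) by exact: preimage_measurable.
apply/eqP; rewrite eq_le measure_ge0 andbT -(D0 A mA AD).
by apply: le_measure; rewrite ?inE//; exact: measurableI.
Qed.

End event_law.

(** By Radon-Nikodym, the law of Z on E has a density k with respect to the law
    of Z, so that k(Z) is the conditional probability of E; the integral identity
    is the change of variables between these two laws. *)
Lemma cond_prob_pullout (E : set T) : measurable E -> exists k : TZ -> R,
  [/\ measurable_fun setT k, forall z, 0 <= k z &
      forall (g : TZ -> \bar R) D, measurable_fun setT g ->
        (forall z, 0 <= g z)%E -> measurable D ->
      (\int[P]_(w in Z @^-1` D) (g (Z w) * (k (Z w))%:E) =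
       \int[P]_(w in Z @^-1` D `&` E) g (Z w))%E].
Proof.
move=> mE; have dom := event_law_dominates mE.
set f := Radon_Nikodym_SigmaFinite.f (event_law mE) (distribution P Z).
have f0 : forall x, (0 <= f x)%E := Radon_Nikodym_SigmaFinite.f_ge0 dom.
have ffin : forall x, f x \is a fin_num :=
  Radon_Nikodym_SigmaFinite.f_fin_num dom.
have mf : measurable_fun setT f.
  exact: measurable_int (Radon_Nikodym_SigmaFinite.f_integrable dom).
exists (fine \o f); split.
- exact: measurableT_comp.
- by move=> z /=; exact: fine_ge0.
move=> g D mg g0 mD; under eq_integral do rewrite /= fineK//.
have mZD : measurable (Z @^-1` D) by exact: preimage_measurable.
have mgD : measurable_fun D g by exact: measurable_funTS.
rewrite -(ge0_integral_mrestr P mE)//.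
- rewrite -(ge0_integral_pushforward _ (mrestr P mE) mD mgD)//.
  rewrite -[pushforward _ _]/(event_law mE).
  rewrite -(Radon_Nikodym_SigmaFinite.change_of_variables dom g0 mD mgD).
  rewrite /distribution ge0_integral_pushforward//.
  + by apply: emeasurable_funM => //; exact: measurable_funTS.
  + by move=> z _; rewrite mule_ge0.
- by apply: measurable_funTS; exact: measurableT_comp.
Qed.

Lemma is_cond_prob_ge0 (E : set T) (h : TZ -> R) :
  measurable E -> measurable_fun setT h -> (forall z, 0 <= h z) ->
  (forall D, measurable D ->
    \int[P]_(w in Z @^-1` D) (h (Z w))%:E = P (E `&` Z @^-1` D))%E ->
  is_cond_prob P Z E (h \o Z).
Proof.
move=> mE mh h0 hE; split => [V mV||D mD]; last exact: hE.
- exists (h @^-1` V); first exact: preimage_measurable.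
  by rewrite setTI.
- apply/integrableP; split.
    by apply/measurable_EFinP; exact: measurableT_comp.
  under eq_integral do rewrite /= ger0_norm//.
  rewrite -(preimage_setT Z) hE// preimage_setT setIT.
  by rewrite -ge0_fin_numE// fin_num_measure.
Qed.

Lemma is_cond_prob_pullout (E : set T) (k : TZ -> R) :
  measurable E -> measurable_fun setT k -> (forall z, 0 <= k z) ->
  (forall (g : TZ -> \bar R) D, measurable_fun setT g ->
     (forall z, 0 <= g z)%E -> measurable D ->
   (\int[P]_(w in Z @^-1` D) (g (Z w) * (k (Z w))%:E) =
    \int[P]_(w in Z @^-1` D `&` E) g (Z w))%E) ->
  is_cond_prob P Z E (k \o Z).
Proof.
move=> mE mk k0 kE; apply: is_cond_prob_ge0 => // D mD.
have := kE (cst 1%E) D (measurable_cst _) (fun=> lee01) mD.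
under eq_integral do rewrite mul1e.
move=> ->; rewrite integral_cst ?mul1e//; first by rewrite setIC.
by apply: measurableI => //; exact: preimage_measurable.
Qed.

(** Both versions factor through Z, so the comparison takes place under the law
    of Z, where the two factors have the same integral over every set. *)
Lemma is_cond_prob_unique (E : set T) (u v : T -> R) :
  is_cond_prob P Z E u -> is_cond_prob P Z E v ->
  {ae P, forall w, u w = v w}.
Proof.
move=> [uZ iu uE] [vZ iv vE].
have [h mh uh] := sigma_preimage_factor uZ.
have [k mk vk] := sigma_preimage_factor vZ.
subst u v.
have mEh : measurable_fun setT (EFin \o h) by exact/measurable_EFinP.
have mEk : measurable_fun setT (EFin \o k) by exact/measurable_EFinP.
have : ae_eq (distribution P Z) setT (EFin \o h) (EFin \o k).
  apply: integral_ae_eq => //.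
    by apply: integrable_pushforward => //; rewrite preimage_setT.
  move=> D _ mD; rewrite /distribution !integral_pushforward//.
  - by rewrite [LHS](uE D mD) -(vE D mD).
  - by apply: (integrableS measurableT) iv => //; exact: preimage_measurable.
  - by apply: (integrableS measurableT) iu => //; exact: preimage_measurable.
move=> [N [mN N0 hk]]; exists (Z @^-1` N); split => //.
  exact: preimage_measurable.
move=> w /= huv; apply: hk => /= H; apply: huv.
exact: EFin_inj (H I).
Qed.

Context d1 d2 (T1 : measurableType d1) (T2 : measurableType d2).
Variables (Y : {mfun T >-> T1}) (X : {mfun T >-> T2}).

(** The function h is a version of P(Y \in B | Z).  With k(Z) = P(X \in C | Z),
    the integral of h(Z) over X \in C is that of h(Z) k(Z) over the whole space,
    and this product is P(Y \in B, X \in C | Z) by conditional independence. *)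
Lemma cond_indep_regression : cond_indep P Y X Z -> forall B, measurable B ->
  exists h : TZ -> R, [/\ measurable_fun setT h, forall z, 0 <= h z &
    forall C, measurable C ->
    (\int[P]_(w in X @^-1` C) (h (Z w))%:E)%E = P (Y @^-1` B `&` X @^-1` C)].
Proof.
move=> YXZ B mB.
have mYB : measurable (Y @^-1` B) by exact: preimage_measurable.
have [h [mh h0 hE]] := cond_prob_pullout mYB.
exists h; split => // C mC.
have mXC : measurable (X @^-1` C) by exact: preimage_measurable.
have [k [mk k0 kE]] := cond_prob_pullout mXC.
have [u [v [r [uP vP rP ruv]]]] := YXZ B C mB mC.
have mhZ : measurable_fun setT (fun z => (h z)%:E) by exact/measurable_EFinP.
have mkZ : measurable_fun setT (fun z => (k z)%:E) by exact/measurable_EFinP.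
have [_ ir rE] := rP.
have := rE _ measurableT; rewrite preimage_setT setIT => <-.
have uh := is_cond_prob_unique uP (is_cond_prob_pullout mYB mh h0 hE).
have vk := is_cond_prob_unique vP (is_cond_prob_pullout mXC mk k0 kE).
transitivity (\int[P]_w ((h (Z w))%:E * (k (Z w))%:E))%E.
  have := kE _ setT mhZ h0 measurableT.
  by rewrite preimage_setT setTI.
apply: ae_eq_integral => //.
- apply: emeasurable_funM; first exact: (measurableT_comp mhZ).
  exact: (measurableT_comp mkZ).
- exact: measurable_int ir.
- apply: filterS3 uh vk ruv => w uw vw rw _.
  by rewrite rw uw vw EFinM.
Qed.

(** The argument of [cond_indep_regression] read backwards.  With
    k(Z) = P(X \in C | Z), the integral of h(Z) k(Z) over an event of Z is that
    of h(Z) over its intersection with X \in C, and this is again an event of X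
    because Z is a function of X. *)
Lemma cond_indep_of_regression (psi : T2 -> TZ) :
  measurable_fun setT psi -> Z = psi \o X :> (T -> TZ) ->
  (forall B, measurable B ->
  exists h : TZ -> R, [/\ measurable_fun setT h, forall z, 0 <= h z &
    forall C, measurable C ->
    (\int[P]_(w in X @^-1` C) (h (Z w))%:E)%E = P (Y @^-1` B `&` X @^-1` C)]) ->
  cond_indep P Y X Z.
Proof.
move=> mpsi ZX H B C mB mC.
have [h [mh h0 hE]] := H B mB.
have mYB : measurable (Y @^-1` B) by exact: preimage_measurable.
have mXC : measurable (X @^-1` C) by exact: preimage_measurable.
have [k [mk k0 kE]] := cond_prob_pullout mXC.
have mhZ : measurable_fun setT (fun z => (h z)%:E) by exact/measurable_EFinP.
have ZD D : Z @^-1` D = X @^-1` (psi @^-1` D) by rewrite ZX.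
exists (h \o Z), (k \o Z), ((fun z => h z * k z) \o Z); split; last first.
- by apply: aeW => w.
- apply: is_cond_prob_ge0 => //.
  + exact: measurableI.
  + exact: measurable_funM.
  + by move=> z; exact: mulr_ge0.
  + move=> D mD; under eq_integral do rewrite EFinM.
    rewrite (kE _ D mhZ h0 mD) -setIA ZD.
    rewrite -preimage_setI hE.
      by rewrite preimage_setI (setIC (X @^-1` C)).
    by apply: measurableI => //; exact: preimage_measurable.
- exact: is_cond_prob_pullout.
- apply: is_cond_prob_ge0 => // D mD; rewrite ZD.
  by apply: hE; exact: preimage_measurable.
Qed.

End conditional_probability.

(** * Euclidean norm, direction and the scaling of Lebesgue measure *)

Section norm_direction.
Context {R : realType}.

Lemma enorm_ge0 n (x : 'cV[R]_n) : 0 <= enorm x.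
Proof. exact: sqrtr_ge0. Qed.

Lemma measurable_enorm n : measurable_fun setT (@enorm R n).
Proof.
pose s := fun x : 'cV[R]_n => \sum_i x i 0 ^+ 2.
(* square roots and inverses are powers, whose measurability is known *)
rewrite (_ : enorm = (@powR R ^~ 2^-1) \o s).
  apply: measurableT_comp; first exact: measurable_powR.
  apply: measurable_sum => i; apply: measurable_funX; exact: measurable_coord.
apply/funext => x; rewrite /= powR12_sqrt//.
by apply: sumr_ge0 => i _; exact: sqr_ge0.
Qed.

Lemma measurable_edir n : measurable_fun setT (@edir R n).
Proof.
apply: measurable_fun_coordP => i; rewrite /edir.
under eq_fun do rewrite mxE -powR_inv1 ?enorm_ge0//.
apply: measurable_funM; last exact: measurable_coord.
exact: (measurableT_comp (measurable_powR (-1)) (@measurable_enorm n)).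
Qed.

HB.instance Definition _ n :=
  isMeasurableFun.Build _ _ _ _ (@enorm R n) (@measurable_enorm n).
HB.instance Definition _ n :=
  isMeasurableFun.Build _ _ _ _ (@edir R n) (@measurable_edir n).

Lemma measurable_mulmx m n (A : 'M[R]_(m, n)) :
  measurable_fun setT (fun x : 'cV[R]_n => A *m x).
Proof.
apply: measurable_fun_coordP => i; under eq_fun do rewrite mxE.
apply: measurable_sum => j; apply: measurable_funM => //.
exact: measurable_coord.
Qed.

HB.instance Definition _ m n (A : 'M[R]_(m, n)) :=
  isMeasurableFun.Build _ _ _ _ (mulmx A : 'cV[R]_n -> 'cV[R]_m)
    (measurable_mulmx A).

Lemma measurable_scale n :
  measurable_fun setT (fun z : 'cV[R]_n * R => z.2 *: z.1).
Proof.
apply: measurable_fun_coordP => i; under eq_fun do rewrite mxE.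
apply: measurable_funM; first exact: measurable_snd.
exact: (measurableT_comp (measurable_coord i) measurable_fst).
Qed.

Lemma enormZ n t (x : 'cV[R]_n) : 0 <= t -> enorm (t *: x) = t * enorm x.
Proof.
move=> t0; rewrite /enorm; under eq_bigr do rewrite mxE exprMn.
by rewrite -mulr_sumr sqrtrM ?sqr_ge0// sqrtr_sqr ger0_norm.
Qed.

Lemma edirZ n t (x : 'cV[R]_n) : 0 < t -> edir (t *: x) = edir x.
Proof.
move=> t0; rewrite /edir enormZ ?ltW// scalerA invfM mulrAC mulVf ?mul1r//.
by rewrite gt_eqF.
Qed.

Lemma coord_le_enorm n (x : 'cV[R]_n) i : `|x i 0| <= enorm x.
Proof.
rewrite -sqrtr_sqr ler_wsqrtr// (bigD1 i)//= lerDl.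
by apply: sumr_ge0 => k _; exact: sqr_ge0.
Qed.

Lemma enorm_eq0 n (x : 'cV[R]_n) : enorm x = 0 -> x = 0.
Proof.
move=> x0; apply/matrixP => i j; rewrite (ord1 j) mxE; apply/eqP.
by rewrite -normr_le0 -x0 coord_le_enorm.
Qed.

Lemma measurable_box n (a b : 'cV[R]_n) :
  measurable [set x : 'cV[R]_n | forall i, x i 0 \in `]a i 0, b i 0]].
Proof.
rewrite (_ : mkset _ = \bigcap_(i in [set: 'I_n])
    (fun x : 'cV[R]_n => x i 0) @^-1` `]a i 0, b i 0]); last first.
  by apply/seteqP; split => x /= H i; [move=> _|]; exact: H.
apply: fin_bigcap_measurable => // i _.
by apply: preimage_measurable => //; exact: measurable_coord.
Qed.

Lemma enorm_edir n (x : 'cV[R]_n) : enorm x *: edir x = x.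
Proof.
rewrite /edir scalerA; have [/enorm_eq0->|x0] := eqVneq (enorm x) 0.
  by rewrite scaler0.
by rewrite mulfV// scale1r.
Qed.

End norm_direction.

Section scaling.
Context {R : realType}.
Local Notation mR := (measurableTypeR R).

Lemma lebesgue_measure_scale (t : R) (A : set mR) : 0 < t -> measurable A ->
  (t%:E * lebesgue_measure (( *%R t : mR -> mR) @^-1` A))%E =
  lebesgue_measure A.
Proof.
move=> t0 mA; apply/esym.
apply: (lebesgue_measure_unique (mu := mscale (NngNum (ltW t0))
  (pushforward lebesgue_measure ( *%R t : mR -> mR)))) => //.
move=> _ [[a b] /= _ <-]; rewrite /mscale /pushforward /=.
transitivity
  (t%:E * lebesgue_measure (`](t^-1 * a)%R, (t^-1 * b)%R] : set R))%E.
  rewrite !lebesgue_measure_itv /= !lte_fin ltr_pM2l ?invr_gt0//.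
  case: ifPn => _; last by rewrite mule0.
  by rewrite -!EFinD -EFinM mulrBr !mulrA mulfV ?gt_eqF// !mul1r.
congr (_ * lebesgue_measure _)%E.
by apply/seteqP; split => x /=; rewrite !in_itv /= ltr_pdivrMl// ler_pdivlMl.
Qed.

(** By induction on the dimension: on products of measurable sets, the two sides
    agree by the scaling of each factor, and the product measure is determined by
    its values there. *)
Lemma lebesgue_cV_scale n (t : R) (A : set 'cV[R]_n) : 0 < t -> measurable A ->
  ((t ^+ n)%:E * lebesgue_cV n ( *:%R t @^-1` A))%E = lebesgue_cV n A.
Proof.
move=> t0; elim: n A => [|n IH] A mA.
  rewrite expr0 mul1e /= !diracE; congr (_%:R%:E); congr (nat_of_bool _).
  by congr (_ \in _); apply/seteqP; split => x /=; rewrite (flatmx0 x) scaler0.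
rewrite /= /lebesgue_cV_step /pushforward /=.
pose s (z : mR * 'cV[R]_n) : mR * 'cV[R]_n := (t * z.1, t *: z.2).
have -> : @cV_cons R n @^-1` ( *:%R t @^-1` A) = s @^-1` (@cV_cons R n @^-1` A).
  apply/seteqP; split => z /=; rewrite (_ : t *: cV_cons z = cV_cons (s z))//;
  apply/matrixP => i j; rewrite !mxE; case: (unlift ord0 i) => //= k;
  by rewrite mxE.
have mcA : measurable (@cV_cons R n @^-1` A).
  by apply: preimage_measurable => //; exact: measurable_cV_cons.
apply/esym.
apply: (product_measure_unique
  (m' := mscale (NngNum (exprn_ge0 n.+1 (ltW t0)))
           (pushforward (lebesgue_measure \x lebesgue_cV n)%E s))) => //.
  apply: measurable_fun_pair.
    by apply: measurable_funM => //; exact: measurable_fst.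
  apply: measurable_fun_coordP => i; under eq_fun do rewrite mxE.
  apply: measurable_funM => //.
  exact: (measurableT_comp (measurable_coord i) measurable_snd).
move=> ms B C mB mC.
transitivity ((t ^+ n.+1)%:E * (lebesgue_measure \x lebesgue_cV n)
  (( *%R t : mR -> mR) @^-1` B `*` ( *:%R t @^-1` C)))%E; first by [].
rewrite product_measure1E.
- rewrite -(IH _ mC) exprS EFinM muleACA; congr (_ * _)%E.
  exact: lebesgue_measure_scale.
- by apply: preimage_measurable => //; exact: measurable_funM.
- apply: preimage_measurable => //; apply: measurable_fun_coordP => i.
  under eq_fun do rewrite mxE.
  by apply: measurable_funM => //; exact: measurable_coord.
Qed.

End scaling.

(** * Independence of the norm and the direction of a spherical vector *)

Section polar.
Context {R : realType} (n : nat).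
Local Notation lambda := (@lebesgue_cV R n).
Implicit Types (C : set 'cV[R]_n) (D : set R).

Definition uball := @enorm R n @^-1` `]-oo, 1[.

Lemma measurable_uball : measurable uball.
Proof. exact: preimage_measurable. Qed.

Let measurable_cone C : measurable C -> measurable (@edir R n @^-1` C).
Proof. by move=> mC; exact: preimage_measurable. Qed.

Lemma cone_ball_scale C t : measurable C -> 0 < t ->
  lambda (@enorm R n @^-1` `]-oo, t[ `&` @edir R n @^-1` C) =
  ((t ^+ n)%:E * lambda (uball `&` @edir R n @^-1` C))%E.
Proof.
move=> mC t0; rewrite -(lebesgue_cV_scale t0).
  congr (_ * lambda _)%E; apply/seteqP; split => x /=;
  rewrite !in_itv /= edirZ// enormZ ?ltW// => -[xt ?]; split => //; move: xt;
  by rewrite -ltr_pdivlMl// mulVf// gt_eqF.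
by apply: measurableI; exact: preimage_measurable.
Qed.

Lemma uball_lty : (lambda uball < +oo)%E.
Proof.
pose a : 'cV[R]_n := const_mx (-1); pose b : 'cV[R]_n := const_mx 1.
have ab i : a i 0 <= b i 0 by rewrite !mxE; lra.
apply: (@le_lt_trans _ _
  (lambda [set x | forall i, x i 0 \in `]a i 0, b i 0]])); last first.
  by rewrite (lebesgue_cV_box ab) ltry.
apply: le_measure; rewrite ?inE.
- exact: measurable_uball.
- exact: measurable_box.
move=> x; rewrite /uball /= in_itv /= => x1 i; rewrite in_itv /= !mxE.
have /ler_normlP[] := ltW (le_lt_trans (coord_le_enorm x i) x1).
have := le_lt_trans (coord_le_enorm x i) x1; rewrite ltr_norml; lra.
Qed.

Lemma uball_gt0 : (0 < lambda uball)%E.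
Proof.
(* the box of side e is inside the ball because e <= 1 and n * e < 1 *)
pose e : R := n.+1%:R^-1.
have e0 : 0 < e by rewrite invr_gt0.
have e1 : e <= 1 by rewrite invf_le1// ler1n.
pose a : 'cV[R]_n := const_mx 0; pose b : 'cV[R]_n := const_mx e.
have ab i : a i 0 <= b i 0 by rewrite !mxE ltW.
apply: (@lt_le_trans _ _ (\prod_(i < n) (b i 0 - a i 0))%:E).
  by rewrite lte_fin; apply: prodr_gt0 => i _; rewrite !mxE subr0.
rewrite -(lebesgue_cV_box ab).
apply: le_measure; rewrite ?inE.
- exact: measurable_box.
- exact: measurable_uball.
move=> x /= H; rewrite /uball /= in_itv /= /enorm -[ltRHS]sqrtr1 ltr_sqrt//.
apply: (@le_lt_trans _ _ (\sum_(i < n) e)).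
  apply: ler_sum => i _; have := H i; rewrite in_itv /= !mxE => /andP[x0 xe].
  by rewrite expr2; nra.
by rewrite sumr_const card_ord -mulr_natl ltr_pdivrMr// mul1r ltr_nat.
Qed.

Let uball_fin_num : lambda uball \is a fin_num.
Proof. by rewrite ge0_fin_numE// uball_lty. Qed.

Let uball_cone_fin_num C : measurable C ->
  lambda (uball `&` @edir R n @^-1` C) \is a fin_num.
Proof.
move=> mC; rewrite ge0_fin_numE//; apply: le_lt_trans uball_lty.
apply: le_measure; rewrite ?inE//; last exact: measurable_uball.
by apply: measurableI; [exact: measurable_uball|exact: measurable_cone].
Qed.

(** Both sides are measures in D.  On the open ray below t > 0 the scaling makes
    each of them t ^ n times the same product of constants, on the other open
    rays below a point they vanish, and these rays generate the Borel sets. *)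
Lemma cone_proportional C D : measurable C -> measurable D ->
  (lambda uball * lambda (@enorm R n @^-1` D `&` @edir R n @^-1` C) =
   lambda (uball `&` @edir R n @^-1` C) * lambda (@enorm R n @^-1` D))%E.
Proof.
move=> mC mD; have mcone := measurable_cone mC.
have fU := uball_fin_num; have fUC := uball_cone_fin_num mC.
have a0 : 0 <= fine (lambda uball) by exact: fine_ge0.
have b0 : 0 <= fine (lambda (uball `&` @edir R n @^-1` C)) by exact: fine_ge0.
suff : mscale (NngNum a0) (pushforward (mrestr lambda mcone) (@enorm R n)) D =
       mscale (NngNum b0) (pushforward lambda (@enorm R n)) D.
  move=> H.
  rewrite -[X in (X * _ = _)%E](fineK fU) -[X in (_ = X * _)%E](fineK fUC).
  exact: (H (@measurable_enorm R n) (@measurable_enorm R n)).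
move=> mN mN'.
apply: (measure_unique (@RGenInftyO.G R) (fun k => `]-oo, k%:R[%classic)) => //.
- exact: RGenInftyO.measurableE.
- move=> _ _ [x ->] [y ->]; exists (Num.min x y).
  by apply/seteqP; split => z /=; rewrite !in_itv /= lt_min => /andP.
- by move=> k; exists k%:R.
- apply/seteqP; split => // x _; exists (Num.truncn x).+1 => //=.
  by rewrite in_itv /= truncnS_gt.
- move=> _ [t ->]; rewrite /= /mscale /= (fineK fU) (fineK fUC).
  have [t0|t0] := leP t 0.
    rewrite /pushforward /mrestr.
    rewrite (_ : _ @^-1` _ = set0) ?set0I ?measure0 ?mule0//.
    apply/seteqP; split => x //=; rewrite in_itv /= => xt.
    by have := lt_le_trans xt t0; rewrite ltNge enorm_ge0.
  rewrite /pushforward /mrestr cone_ball_scale//.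
  have := cone_ball_scale measurableT t0; rewrite preimage_setT !setIT => ->.
  by rewrite muleCA [RHS]muleCA (muleC (lambda uball)).
- move=> k; rewrite /= /mscale /= (fineK fU) /pushforward /mrestr.
  have k0 : (0 : R) < k.+1%:R by [].
  apply: (@le_lt_trans _ _
    (lambda uball * ((k.+1%:R ^+ n)%:E * lambda uball))%E).
    rewrite lee_wpmul2l//.
    have := cone_ball_scale measurableT k0; rewrite preimage_setT !setIT => <-.
    have mb r : measurable (@enorm R n @^-1` `]-oo, r[).
      exact: preimage_measurable.
    apply: le_measure; rewrite ?inE//; first exact: measurableI.
    move=> x [] /=; rewrite !in_itv /= => xk _; apply: (lt_le_trans xk).
    by rewrite ler_nat.
  by rewrite -(fineK fU) -!EFinM ltry.
Qed.

Variables (d : measure_display) (T : measurableType d) (P : probability T R).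

(** The probability that the norm lies in D and the direction in C is the
    integral of f (r ^ 2) over D for the image under the norm of Lebesgue measure
    on the cone over C.  These images are proportional for different C, whence
    the same holds for the probabilities as functions of D. *)
Lemma spherical_indep (X : {mfun T >-> 'cV[R]_n}) :
  (0 < n)%N -> spherical P X ->
  forall C D, measurable C -> measurable D ->
  P ((edir \o X) @^-1` C `&` (enorm \o X) @^-1` D) =
  (P ((edir \o X) @^-1` C) * P ((enorm \o X) @^-1` D))%E.
Proof.
move=> n0 [f [mf f0 fE]] C D mC mD.
(* measurability is known of f (|x| ^ 2) as a function of x, not of f; along the
   line through a unit vector it gives that of f (r ^ 2) as a function of r *)
pose e1 : 'cV[R]_n := delta_mx (Ordinal n0) 0.
have e1N (x : 'cV[R]_n) : f (enorm x ^+ 2) = f (enorm (enorm x *: e1) ^+ 2).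
  rewrite enormZ ?enorm_ge0//; suff -> : enorm e1 = 1 by rewrite mulr1.
  rewrite /enorm (bigD1 (Ordinal n0))//= mxE !eqxx expr1n big1 ?addr0 ?sqrtr1//.
  by move=> i /negPf i0; rewrite mxE i0 expr0n.
pose phi (r : R) := (f (enorm (r *: e1) ^+ 2))%:E.
have mphi : measurable_fun setT phi.
  apply/measurable_EFinP.
  apply: (measurableT_comp (f := fun x : 'cV[R]_n => f (enorm x ^+ 2))) => //.
  apply: measurable_fun_coordP => i; under eq_fun do rewrite mxE.
  exact: measurable_funM.
have key E : measurable E ->
  (lambda uball * P ((edir \o X) @^-1` C `&` (enorm \o X) @^-1` E) =
  lambda (uball `&` @edir R n @^-1` C) * P ((enorm \o X) @^-1` E))%E.
  move=> mE; have mcone := measurable_cone mC.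
  have mNE : measurable (@enorm R n @^-1` E) by exact: preimage_measurable.
  have fU := uball_fin_num; have fUC := uball_cone_fin_num mC.
  have a0 : 0 <= fine (lambda uball) by exact: fine_ge0.
  have b0 : 0 <= fine (lambda (uball `&` @edir R n @^-1` C)) by exact: fine_ge0.
  have phi0 x : (0 <= phi x)%E by rewrite lee_fin f0.
  have PE A (mA : measurable A) : P (X @^-1` (@enorm R n @^-1` E `&` A)) =
      (\int[pushforward (mrestr lambda mA) (@enorm R n)]_(r in E) phi r)%E.
    rewrite fE; last exact: measurableI.
    rewrite ge0_integral_pushforward//; last exact: measurable_funTS.
    rewrite ge0_integral_mrestr//.
    - by apply: eq_integral => x _; rewrite e1N.
    - by apply: measurable_funTS; exact: measurableT_comp.
    - by move=> x _; exact: phi0.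
  transitivity (lambda uball *
    P (X @^-1` (@enorm R n @^-1` E `&` @edir R n @^-1` C)))%E.
    by congr (_ * P _)%E; rewrite setIC.
  transitivity (lambda (uball `&` @edir R n @^-1` C) *
    P (X @^-1` (@enorm R n @^-1` E `&` setT)))%E; last first.
    by congr (_ * P _)%E; rewrite setIT.
  rewrite !PE -[X in (X * _ = _)%E](fineK fU) -[X in (_ = X * _)%E](fineK fUC).
  have mphiE : measurable_fun E phi by exact: measurable_funTS.
  rewrite -(ge0_integral_mscale
    (pushforward (mrestr lambda mcone) (@enorm R n)) mE (NngNum a0) mphiE)//.
  rewrite -(ge0_integral_mscale
    (pushforward (mrestr lambda measurableT) (@enorm R n))
    mE (NngNum b0) mphiE)//.
  apply: eq_measure_integral => A mA _.
  rewrite /= /mscale /= (fineK fU) (fineK fUC).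
  by rewrite /pushforward /mrestr setIT cone_proportional.
(* E = setT gives the proportionality constant *)
have := key setT measurableT.
rewrite preimage_setT setIT probability_setT mule1 => UC.
have fU := uball_fin_num.
have /eqP := key D mD; rewrite -UC -muleA => H; apply/eqP.
rewrite eq_le -(lee_pmul2l fU uball_gt0).
by rewrite -[X in _ && X](lee_pmul2l fU uball_gt0) -eq_le.
Qed.

End polar.

(** * From dimension reduction to contour subspaces *)

(** The same matrix serves for X and for its direction: averaging the regression
    function h over the norm of X keeps it a function of A^T times the
    direction. *)
Lemma SDR_SCS (R : realType) (n : nat) (d : measure_display)
    (T : measurableType d) (P : probability T R) (Y : {mfun T >-> R})
    (X : {mfun T >-> 'cV[R]_n}) (S : {vspace 'cV[R]_n}) :
  (0 < n)%N -> spherical P X -> is_SDR P Y X S -> is_SCS P Y X S.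
Proof.
move=> n0 Xsph [k [A [SA YXA]]]; exists k, A; split => //.
pose U : {mfun T >-> 'cV[R]_n} := edir \o X.
pose V : {mfun T >-> R} := enorm \o X.
pose AX : {mfun T >-> 'cV[R]_k} := mulmx A^T \o X.
pose AU : {mfun T >-> 'cV[R]_k} := mulmx A^T \o U.
apply: (@cond_indep_of_regression _ _ _ P _ _ AU _ _ _ _ Y U (mulmx A^T)) => //.
move=> B mB.
have [h [mh h0 hE]] :=
  @cond_indep_regression _ _ _ P _ _ AX _ _ _ _ Y X YXA B mB.
pose hbar z := (\int[distribution P V]_r (h (r *: z))%:E)%E.
have mhs : measurable_fun setT (fun z : 'cV[R]_k * R => (h (z.2 *: z.1))%:E).
  apply/measurable_EFinP; apply: (measurableT_comp mh); exact: measurable_scale.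
have mhbar : measurable_fun setT hbar.
  apply: (measurable_fun_fubini_tonelli_F (m2 := distribution P V) _ mhs) => z.
  by rewrite lee_fin.
have hbar0 z : (0 <= hbar z)%E by apply: integral_ge0 => r _; rewrite lee_fin.
have hbarE C : measurable C ->
    (\int[P]_(w in U @^-1` C) hbar (AU w))%E = P (Y @^-1` B `&` U @^-1` C).
  move=> mC; rewrite [in RHS](_ : U @^-1` C = X @^-1` (@edir R n @^-1` C))//.
  rewrite -hE; last exact: preimage_measurable.
  pose g (z : 'cV[R]_n * R) := (h (z.2 *: (A^T *m z.1)))%:E.
  have mg : measurable_fun setT g.
    apply: (measurableT_comp mhs
      (g := fun z : 'cV[R]_n * R => (A^T *m z.1, z.2))).
    apply: measurable_fun_pair => //.
    exact: (measurableT_comp (measurable_mulmx A^T)).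
  rewrite -[LHS](@indep_integral _ _ _ _ _ _ _ _ U V
    (spherical_indep n0 Xsph) g)//.
  (* X is its norm times its direction *)
  - by apply: eq_integral => w _; rewrite /g /= -linearZ /= enorm_edir.
  - by move=> z; rewrite lee_fin.
(* hbar may take the value +oo, but only on a null set *)
have mhAU : measurable_fun setT (hbar \o AU) by exact: measurableT_comp.
have fin : {ae P, forall w, (hbar \o AU) w \is a fin_num}.
  have : P.-integrable setT (hbar \o AU).
    apply/integrableP; split => //.
    under eq_integral do rewrite /= gee0_abs//.
    have := hbarE setT measurableT; rewrite preimage_setT setIT => ->.
    by rewrite -ge0_fin_numE// fin_num_measure//; exact: preimage_measurable.
  move=> /integrable_ae -/(_ measurableT); apply: filterS => w; exact.
exists (fine \o hbar); split.
- exact: measurableT_comp.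
- by move=> z; exact: fine_ge0.
move=> C mC; rewrite -hbarE//; apply: ge0_ae_eq_integral.
- exact: preimage_measurable.
- apply: measurable_funTS; apply/measurable_EFinP.
  exact: (measurableT_comp _ mhAU).
- exact: measurable_funTS.
- by move=> w _; rewrite lee_fin fine_ge0.
- by move=> w _.
- by apply: filterS fin => w fw _; rewrite /= fineK.
Qed.

Theorem theorem3 (R : realType) (p : nat) (d : measure_display)
    (T : measurableType d) (P : probability T R)
    (Y : {RV P >-> R}) (X : {RV P >-> 'cV[R]_p}) (S : {vspace 'cV[R]_p}) :
  (1 < p)%N ->
  spherical P X ->
  is_central_subspace P Y X S ->
  kernel_contour_subspace P Y X `<=` [set` S] /\
  forall G : {vspace 'cV[R]_p}, is_GCS P Y X G -> (\dim G <= \dim S)%N.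
Proof.
move=> p1 Xsph [SDR_S _].
have SCS_S : is_SCS P Y X S by apply: SDR_SCS => //; exact: ltnW.
by split => [x|G [_ G_min]]; [exact|exact: G_min].
Qed.
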